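(* Let $I \subset S = K[x_1, \dots, x_n]$ be a monomial ideal and $P \in \mathrm{Ass}(I)$. There is a unique monomial $v$ such that $P = (I : v)$ if and only if $P = \langle x_1, \dots, x_n \rangle$ and $P$ has a unique $P$-primary component in the irredundant irreducible decomposition of $I$ (that is, exactly one of the components of this decomposition has radical $P$).
   Context: $K$ is a field. A monomial is a product $x_1^{c_1}\cdots x_n^{c_n}$ with $c_i\in\mathbb{Z}_{\ge 0}$. $\mathrm{Ass}(I)$ is the set of associated primes of $S/I$. The irredundant irreducible decomposition of a monomial ideal $I$ is the unique presentation $I=\bigcap_{i=1}^r Q_i$ in which each $Q_i$ is generated by pure powers of variables (i.e. $Q_i=\langle x_{j_1}^{c_1},\dots,x_{j_m}^{c_m}\rangle$ with distinct $j_1,\dots,j_m$ and all $c_l\ge 1$) and none of the $Q_i$ can be omitted. Such an ideal is $\langle x_{j_1},\dots,x_{j_m}\rangle$-primary. The colon ideal is $(I:v)=\{f\in S : fv\in I\}$. *)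

(* Defs.v *)
From HB Require Import structures.
From mathcomp Require Import all_boot all_order all_algebra ring_quotient.
From mathcomp Require Import boolp classical_sets.
From mathcomp Require Import mpoly.

Set Implicit Arguments.
Unset Strict Implicit.
Unset Printing Implicit Defensive.

Import GRing.Theory.
Local Open Scope classical_set_scope.
Local Open Scope ring_scope.

Section Ideals.
Variable R : comNzRingType.
Implicit Types (A I P : set R) (f g : R).

(* Finite R-linear combinations of elements of A: p.1 is the coefficient and
   p.2 the generator.  The empty combination gives 0, so A = set0 generates
   the zero ideal. *)
Definition ideal_gen A : set R :=
  [set f | exists2 s : seq (R * R),
     (forall p, p \in s -> A p.2) & f = \sum_(p <- s) p.1 * p.2].

Definition colon I f : set R := [set g | I (g * f)].

Definition radical I : set R := [set f | exists k : nat, I (f ^+ k)].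

(* idealr_closed includes properness (1 is not a member). *)
Definition prime_ideal P : Prop :=
  idealr_closed [pred f | f \in P] /\ prime_idealr_closed [pred f | f \in P].

(* The annihilator of the class of f in R/I is colon I f. *)
Definition Ass I : set (set R) :=
  [set P | prime_ideal P /\ exists f, P = colon I f].

End Ideals.

Section MonomialIdeals.
Variables (K : fieldType) (n : nat).
Implicit Types (I Q : set {mpoly K[n]}).

(* Monomials are encoded by their exponent vectors m : 'X_{1..n}. *)
Definition monomial_ideal I : Prop :=
  exists G : set 'X_{1..n}, I = ideal_gen [set 'X_[m] | m in G].

(* A family of pure powers of distinct variables with positive exponents is
   encoded by one exponent vector c: the variables that occur are those with
   c i > 0.  In particular c = 0 gives the zero ideal (no generators). *)
Definition pure_power_ideal (c : 'X_{1..n}) : set {mpoly K[n]} :=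
  ideal_gen [set 'X_i ^+ c i | i in [set i : 'I_n | (0 < c i)%N]].

Definition irredundant_irreducible_decomposition I (r : nat)
    (Q : 'I_r -> set {mpoly K[n]}) : Prop :=
  [/\ forall i, exists c, Q i = pure_power_ideal c,
      I = \bigcap_(i in [set: 'I_r]) Q i &
      forall j, I <> \bigcap_(i in [set i : 'I_r | i != j]) Q i].

(* Every monomial ideal has exactly one such decomposition up to the order of
   the components, so the existential quantifier below is a definite
   description: Q is one of the components of *the* decomposition of I. *)
Definition irreducible_component I Q : Prop :=
  exists r (D : 'I_r -> set {mpoly K[n]}),
    irredundant_irreducible_decomposition I D /\ exists i, D i = Q.

Definition maximal_homogeneous_ideal : set {mpoly K[n]} :=
  ideal_gen (range (fun i : 'I_n => 'X_i)).

End MonomialIdeals.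

Arguments maximal_homogeneous_ideal K n : clear implicits.

(* Main.v *)
Require Import Defs.
From HB Require Import structures.
From mathcomp Require Import all_boot all_order all_algebra ring_quotient.
From mathcomp Require Import boolp classical_sets.
From mathcomp Require Import mpoly.

Set Implicit Arguments.
Unset Strict Implicit.
Unset Printing Implicit Defensive.

Import GRing.Theory.
Local Open Scope classical_set_scope.
Local Open Scope ring_scope.

(** Both conditions of the equivalence are statements about the monomials [x^v]
    that lie outside [I] while all their products [x_i x^v] lie in [I], the
    socle monomials of [S/I].  Write [m] for the ideal of all the variables.

    On the colon side, [(I : x^v) = m] says exactly that [x^v] is a socle
    monomial ([colon_maximalP]).  A prime [P = (I : x^v)] with [v] unique is
    equal to [m]: if some variable [x_i] were outside [P], then
    [(I : x_i x^v) = (P : x_i) = P] would give the second witness [x_i x^v];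
    so [P] contains all the variables, and [x^v] is outside [I] because [P] is
    proper ([unique_colon_maximal]).

    On the decomposition side, the irreducible components with radical [m]
    are exactly the ideals generated by the [x_i^(v_i + 1)], for [x^v] a socle
    monomial ([maximal_irreducible_componentP]).  Such an ideal contains every
    monomial except the divisors of [x^v], which makes it the only irreducible
    ideal that avoids [x^v] and contains all the [x_i x^v]; hence it is the
    component that witnesses that [x^v] is outside [I].  Conversely, if such an
    ideal is a component, irredundancy gives a divisor of [x^v] that belongs to
    all the other components, and this makes [x^v] a socle monomial.  Since
    this ideal determines [v] ([corner_ideal_inj]), there is exactly one
    component with radical [m] if and only if there is exactly one socle
    monomial.

    Passing from a socle monomial to a component requires that [I] has an
    irredundant decomposition at all ([exists_decomposition]).  By Dickson's
    lemma, in the form [upset_truncation], there is a bound [d] such that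
    membership of a monomial in [I] survives the truncation of its exponents
    at [d].  Then [I] is the intersection of the finitely many irreducible
    ideals containing it whose exponents are at most [d], and a minimal
    subfamily with the same intersection is irredundant. *)

(** * Dickson's lemma *)

(** Each tail of the sequence attains its minimum; jump from the index of the
    minimum of one tail to that of the tail that starts just after it. *)
Lemma exists_nondecreasing_subsequence (f : nat -> nat) :
  exists s : nat -> nat,
    (forall i j, (i < j)%N -> (s i < s j)%N) /\
    (forall i j, (i <= j)%N -> (f (s i) <= f (s j))%N).
Proof.
have tail_min N : exists p, (N <= p)%N /\ forall q, (N <= q)%N -> (f p <= f q)%N.
  pose P k := `[< exists2 p, (N <= p)%N & f p = k >].
  have exP : exists k, P k by exists (f N); apply/asboolP; exists N.
  have [k /asboolP[p leNp <-] min_k] := ex_minnP exP.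
  exists p; split=> // q leNq; apply: min_k.
  by apply/asboolP; exists q.
have [a aP] := choice tail_min.
pose s := fix s k := if k is k'.+1 then a (s k').+1 else a 0%N.
have s_min k q : (s k <= q)%N -> (f (s k) <= f q)%N.
  by case: k => [|k] /= /(leq_trans (aP _).1); apply: (aP _).2.
have s_lt : {homo s : i j / (i < j)%N}.
  by apply: homo_ltn => [|k /=]; [exact: ltn_trans | exact: (aP _).1].
exists s; split=> // i j; rewrite leq_eqVlt => /predU1P[-> // | ltij].
by apply: s_min; apply: ltnW (s_lt _ _ ltij).
Qed.

Lemma exists_jointly_nondecreasing_subsequence (I : eqType) (r : seq I)
    (u : nat -> I -> nat) :
  exists s : nat -> nat,
    (forall i j, (i < j)%N -> (s i < s j)%N) /\
    (forall x, x \in r -> forall i j, (i <= j)%N -> (u (s i) x <= u (s j) x)%N).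
Proof.
elim: r => [|x r [s [s_lt us_le]]]; first by exists id.
have [t [t_lt ust_le]] :=
  exists_nondecreasing_subsequence (fun k => u (s k) x).
exists (s \o t); split=> [i j ltij|y]; first exact/s_lt/t_lt.
rewrite inE => /predU1P[-> // | yr] i j leij /=; apply: us_le => //.
move: leij; rewrite leq_eqVlt => /predU1P[-> // | ltij].
exact: ltnW (t_lt _ _ ltij).
Qed.

Definition truncation n d (m : 'X_{1..n}) : 'X_{1..n} :=
  [multinom minn (m i) d | i < n].

(** This is the finiteness that Dickson's lemma provides, without mention of
    generators.  If every bound [d] had a counterexample [u d], a coordinatewise
    nondecreasing subsequence of [u] would contradict this: its first term [w]
    lies in [M] and divides a term of index so large that the truncation does
    not cut below [w]. *)
Lemma upset_truncation n (M : set 'X_{1..n}) :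
    (forall m m', M m -> (m <= m')%MM -> M m') ->
  exists d, forall m, M m -> M (truncation d m).
Proof.
move=> M_up; apply: contrapT => noM.
have bad d : exists m, M m /\ ~ M (truncation d m).
  apply: contrapT => nobad; apply: noM; exists d => m Mm.
  by apply: contrapT => Ntm; apply: nobad; exists m.
have [u uP] := choice bad.
have [s [s_lt us_le]] :=
  exists_jointly_nondecreasing_subsequence (enum 'I_n) (fun k i => u k i).
have le_s k : (k <= s k)%N.
  by elim: k => // k IHk; apply: leq_ltn_trans IHk (s_lt _ _ _).
pose D := mdeg (u (s 0%N)).
apply: (uP (s D)).2; apply: M_up (uP (s 0%N)).1 _; apply/mnm_lepP => i.
rewrite mnmE leq_min us_le ?mem_enum //=; apply: leq_trans (le_s D).
by rewrite /D mdegE (bigD1 i) //= leq_addr.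
Qed.

(** * Membership in monomial ideals *)

Section MonomialIdeals.
Variables (K : fieldType) (n : nat).
Implicit Types (I J P Q : set {mpoly K[n]}) (f g : {mpoly K[n]}).
Implicit Types (m c v : 'X_{1..n}) (G : set 'X_{1..n}).

(** Membership is decided one monomial at a time, because a multiple of ['X_[g]]
    is supported on multiples of [g]. *)
Lemma mem_monomial_ideal_gen G f :
  ideal_gen [set 'X_[m] | m in G] f <->
  forall m, m \in msupp f -> exists2 g, G g & (g <= m)%MM.
Proof.
split=> [[s sG ->] m /msupp_sum_le/flattenP[/= t /mapP[p]] | Gf].
  rewrite filter_predT => ps -> {t}; have [g Gg <-] := sG _ ps.
  rewrite (perm_mem (msuppMX _ _)) => /mapP[m' _ ->].
  by exists g; rewrite ?lem_addr.
have /choice[h hP] m : exists g : 'X_{1..n}, m \in msupp f -> G g /\ (g <= m)%MM.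
  have [fm|_] := boolP (m \in msupp f); last by exists 0%MM.
  by have [g] := Gf m fm; exists g.
exists [seq (f@_m *: 'X_[m - h m], 'X_[h m]) | m <- msupp f].
  by move=> p /mapP[m fm ->] /=; exists (h m) => //; have [] := hP m fm.
rewrite big_map {1}(mpolyE f); apply: eq_big_seq => m fm /=.
by rewrite -scalerAl -mpolyXD submK //; have [] := hP m fm.
Qed.

Lemma monomial_idealP I f : monomial_ideal I ->
  I f <-> forall m, m \in msupp f -> I 'X_[m].
Proof.
case=> G ->; rewrite mem_monomial_ideal_gen; split=> Gf m fm.
  by apply/mem_monomial_ideal_gen => m' /mem_msuppXP <-; apply: Gf.
by have /mem_monomial_ideal_gen := Gf m fm; apply; apply/mem_msuppXP.
Qed.

Lemma monomial_ideal_up I m m' : monomial_ideal I ->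
  I 'X_[m] -> (m <= m')%MM -> I 'X_[m'].
Proof.
case=> G -> /mem_monomial_ideal_gen Gm lemm'.
apply/mem_monomial_ideal_gen => _ /mem_msuppXP <-.
have [|g Gg legm] := Gm m; first exact/mem_msuppXP.
by exists g => //; apply: lepm_trans legm lemm'.
Qed.

(** Exhibits the generators as monomials, so that the general facts on monomial
    ideals apply. *)
Lemma pure_power_idealE c :
  @pure_power_ideal K n c =
  ideal_gen [set 'X_[m] | m in
    [set (U_(i) *+ c i)%MM | i in [set i | (0 < c i)%N]]].
Proof.
rewrite /pure_power_ideal image_comp; congr ideal_gen.
by apply: eq_imagel => i _ /=; rewrite mpolyXn.
Qed.

Lemma pure_power_ideal_monomial c : monomial_ideal (@pure_power_ideal K n c).
Proof. by rewrite pure_power_idealE; eexists. Qed.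

Lemma mem_pure_power_ideal c f :
  @pure_power_ideal K n c f <->
  forall m, m \in msupp f -> exists2 i, (0 < c i)%N & (c i <= m i)%N.
Proof.
rewrite pure_power_idealE mem_monomial_ideal_gen.
split=> cf m /cf[].
  move=> _ [i /= c_gt0 <-] /mnm_lepP/(_ i).
  by rewrite mulmnE mnm1E eqxx mul1n; exists i.
move=> i c_gt0 lecm; exists (U_(i) *+ c i)%MM; first by exists i.
apply/mnm_lepP => j; rewrite mulmnE mnm1E.
by case: eqVneq => [<-|_]; rewrite ?mul1n // mul0n.
Qed.

Lemma mem_pure_power_idealX c m :
  @pure_power_ideal K n c 'X_[m] <-> exists2 i, (0 < c i)%N & (c i <= m i)%N.
Proof.
rewrite mem_pure_power_ideal; split=> [|cm _ /mem_msuppXP <- //].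
by apply; apply/mem_msuppXP.
Qed.

Lemma maximal_homogeneous_idealE :
  maximal_homogeneous_ideal K n = @pure_power_ideal K n [multinom 1%N | _ < n].
Proof.
congr ideal_gen.
have -> : [set i : 'I_n | (0 < [multinom 1 | _ < n] i)%N] = setT.
  by apply/seteqP; split=> // i _ /=; rewrite mnmE.
by apply: eq_imagel => i _; rewrite mnmE expr1.
Qed.

Lemma mem_maximal_homogeneous_ideal f :
  maximal_homogeneous_ideal K n f <-> f@_0%MM = 0.
Proof.
rewrite maximal_homogeneous_idealE mem_pure_power_ideal.
split=> [posf | /eqP f0 m fm].
  apply/eqP; rewrite mcoeff_eq0; apply/negP => /posf[i].
  by rewrite mnmE mnm0E.
have /eqP/mnmP m_neq0 : m != 0%MM.
  by apply: contraTneq fm => ->; rewrite -mcoeff_eq0.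
apply: contrapT => no_i; apply: m_neq0 => i; rewrite mnm0E.
apply: contrapT => /eqP; rewrite -lt0n => m_gt0; apply: no_i.
by exists i; rewrite mnmE.
Qed.

(** * Socle monomials *)

Definition socle_monomial I v :=
  ~ I 'X_[v] /\ forall i, I 'X_[v + U_(i)].

(** [x^v] outside [I] keeps the constants out of the colon ideal, and the
    products [x_i x^v] in [I] put every variable in it. *)
Lemma colon_maximalP I v : monomial_ideal I ->
  maximal_homogeneous_ideal K n = colon I 'X_[v] <-> socle_monomial I v.
Proof.
move=> mI; split=> [mE | [NIv Iv]].
  split=> [Iv | i].
    have: colon I 'X_[v] 1 by rewrite /colon /= mul1r.
    rewrite -mE => /mem_maximal_homogeneous_ideal/eqP.
    by rewrite mcoeff1 eqxx oner_eq0.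
  have: colon I 'X_[v] 'X_i.
    by rewrite -mE; apply/mem_maximal_homogeneous_ideal; rewrite mcoeffX mnm1_eq0.
  by rewrite /colon /= -mpolyXD addmC.
apply/seteqP; split=> f.
  rewrite maximal_homogeneous_idealE => /mem_pure_power_ideal posf.
  apply/(monomial_idealP _ mI) => m'.
  rewrite (perm_mem (msuppMX _ _)) => /mapP[m /posf[i _]]; rewrite mnmE => m_gt0 ->.
  apply: monomial_ideal_up mI (Iv i) _; apply/mnm_lepP => j.
  by rewrite !mnmDE leq_add2l mnm1E; case: eqVneq => // <-.
rewrite /colon /= => /(monomial_idealP _ mI) Ifv.
apply/mem_maximal_homogeneous_ideal/eqP; rewrite mcoeff_eq0.
apply/negP => f0; apply: NIv; apply: Ifv.
by rewrite (perm_mem (msuppMX _ _)); apply/mapP; exists 0%MM; rewrite ?addm0.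
Qed.

(** [(I : x_i x^v) = (P : x_i)], which is [P] because [P] is prime and does not
    contain [x_i]. *)
Lemma colon_shift_prime I P v i : prime_ideal P ->
  P = colon I 'X_[v] -> ~ P 'X_i -> P = colon I 'X_[v + U_(i)].
Proof.
move=> [[P0 _ Plin] Pprime] PE NPi.
have -> : colon I 'X_[v + U_(i)] = [set f | P (f * 'X_i)].
  by apply/seteqP; split=> f; rewrite PE /colon /= addmC mpolyXD mulrA.
apply/seteqP; split=> f /=.
  move=> Pf; have := Plin 'X_i f 0; rewrite !inE addr0 mulrC.
  by move: P0; rewrite !inE => P0 /(_ Pf P0).
by move=> /mem_set/Pprime/orP[]; rewrite !inE.
Qed.

Lemma unique_colon_maximal I P : monomial_ideal I -> prime_ideal P ->
  (exists! v, P = colon I 'X_[v]) -> P = maximal_homogeneous_ideal K n.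
Proof.
move=> mI pP [v [PE v_uniq]].
have PX i : P 'X_i.
  apply: contrapT => /(colon_shift_prime pP PE)/v_uniq/mnmP/(_ i)/eqP.
  by rewrite mnmDE mnm1E eqxx -{1}[v i]addn0 eqn_add2l.
rewrite {1}PE; apply/esym/colon_maximalP => //; split=> [Iv | i].
  have [[_ /negP + _] _] := pP; apply; rewrite !inE PE /colon /= mul1r //.
by have := PX i; rewrite PE /colon /= -mpolyXD addmC.
Qed.

(** * Irreducible components *)

(** The exponents of the irreducible ideal whose standard monomials are the
    divisors of [x^v]; see [mem_corner_idealX]. *)
Definition corner v : 'X_{1..n} := [multinom (v i).+1 | i < n].

Lemma mem_corner_idealX v m :
  @pure_power_ideal K n (corner v) 'X_[m] <-> ~ (m <= v)%MM.
Proof.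
rewrite mem_pure_power_idealX; split=> [[i _] | Nlemv].
  by rewrite mnmE => ltvm /mnm_lepP/(_ i); rewrite leqNgt ltvm.
apply: contrapT => no_i; apply: Nlemv; apply/mnm_lepP => i; rewrite leqNgt.
by apply/negP => ltvm; apply: no_i; exists i; rewrite mnmE.
Qed.

(** [x^v] is the largest monomial outside the ideal. *)
Lemma corner_ideal_inj v v' :
  @pure_power_ideal K n (corner v) = @pure_power_ideal K n (corner v') -> v = v'.
Proof.
have le_of_eq w w' :
    @pure_power_ideal K n (corner w) = @pure_power_ideal K n (corner w') ->
    (w <= w')%MM.
  move=> eqw; apply: contrapT => /mem_corner_idealX.
  by rewrite -eqw => /mem_corner_idealX; rewrite lepm_refl.
move=> eqv; apply/mnmP => i; apply/eqP; rewrite eqn_leq.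
by rewrite (mnm_lepP (le_of_eq _ _ eqv)) (mnm_lepP (le_of_eq _ _ (esym eqv))).
Qed.

Lemma msupp_exp_mdeg f k m :
  f@_0%MM = 0 -> m \in msupp (f ^+ k) -> (k <= mdeg m)%N.
Proof.
move=> f0; elim: k m => // k IHk m; rewrite exprS.
move=> /msuppM_le/allpairsP[[m1 m2] /= [fm1 /IHk le_k ->]].
rewrite mdegD -add1n leq_add // lt0n mdeg_eq0.
by apply: contraTneq fm1 => ->; rewrite -mcoeff_eq0 f0.
Qed.

(** When every variable occurs, a monomial outside the ideal has degree at most
    [mdeg c], whereas a high power of a polynomial without constant term has
    only monomials of high degree. *)
Lemma radical_pure_power_idealP c :
  radical (@pure_power_ideal K n c) = maximal_homogeneous_ideal K n <->
  forall i, (0 < c i)%N.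
Proof.
split=> [radE i | c_gt0].
  have : maximal_homogeneous_ideal K n 'X_i.
    by apply/mem_maximal_homogeneous_ideal; rewrite mcoeffX mnm1_eq0.
  rewrite -radE => -[k]; rewrite mpolyXn => /mem_pure_power_idealX[j].
  rewrite mulmnE mnm1E; case: eqVneq => [-> // | _ cj].
  by rewrite mul0n leqNgt cj.
apply/seteqP; split=> f.
  case=> k /mem_pure_power_ideal posfk; apply/mem_maximal_homogeneous_ideal.
  have : (f ^+ k)@_0%MM = 0.
    apply/eqP; rewrite mcoeff_eq0; apply/negP => /posfk[i].
    by rewrite mnm0E => + c0; rewrite ltnNge c0.
  by rewrite rmorphXn => /eqP; rewrite expf_eq0 => /andP[_ /eqP].
move=> /mem_maximal_homogeneous_ideal f0; exists (mdeg c).+1.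
apply/mem_pure_power_ideal => m /(msupp_exp_mdeg f0).
apply: contraPP => no_i; apply/negP; rewrite -leqNgt !mdegE.
apply: leq_sum => i _; rewrite leqNgt; apply/negP => ltcm.
by apply: no_i; exists i => //; apply: ltnW.
Qed.

Section Decomposition.
Variables (I : set {mpoly K[n]}) (r : nat) (D : 'I_r -> set {mpoly K[n]}).
Hypothesis mI : monomial_ideal I.
Hypothesis decI : irredundant_irreducible_decomposition I D.

(** A component that avoids [x^v] but contains [x_j x^v] must have the generator
    [x_j^(v_j + 1)]: only in the coordinate [j] do the two monomials differ. *)
Lemma socle_monomial_component v : socle_monomial I v ->
  exists i, D i = @pure_power_ideal K n (corner v).
Proof.
have [Dc IE _] := decI => -[NIv Iv].
have [i NDiv] : exists i, ~ D i 'X_[v].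
  apply: contrapT => allD; apply: NIv; rewrite IE => i _.
  by apply: contrapT => NDi; apply: allD; exists i.
exists i; have [c DiE] := Dc i; rewrite DiE in NDiv *; congr pure_power_ideal.
apply/mnmP => j; rewrite mnmE.
have := Iv j; rewrite IE => /(_ i Logic.I); rewrite DiE.
case/mem_pure_power_idealX => k c_gt0; rewrite mnmDE mnm1E => le_ck.
have lt_vk : (v k < c k)%N.
  rewrite ltnNge; apply/negP => le_cv; apply: NDiv.
  by apply/mem_pure_power_idealX; exists k.
move: le_ck; case: eqVneq => [-> | _]; last by rewrite addn0 leqNgt lt_vk.
by rewrite addn1 => le_ck; apply/eqP; rewrite eqn_leq le_ck.
Qed.

(** Irredundancy produces a monomial [x^u] in all the other components and
    outside [D i].  It divides [x^v], the largest monomial outside [D i], so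
    [x^v] and its multiples lie in all the other components as well. *)
Lemma maximal_component_socle i :
    radical (D i) = maximal_homogeneous_ideal K n ->
  exists2 v, socle_monomial I v & D i = @pure_power_ideal K n (corner v).
Proof.
have [Dc IE irr] := decI; have [c DiE] := Dc i.
rewrite DiE => /radical_pure_power_idealP c_gt0.
pose v : 'X_{1..n} := [multinom (c j).-1 | j < n].
have cE : c = corner v by apply/mnmP => j; rewrite !mnmE prednK.
rewrite {}cE in DiE *; exists v => //.
have NDiv : ~ D i 'X_[v] by rewrite DiE mem_corner_idealX lepm_refl.
split=> [|k]; first by rewrite IE => /(_ i Logic.I).
have [f fD NDif] : exists2 f, (forall j, j != i -> D j f) & ~ D i f.
  apply: contrapT => no_f; apply: (irr i); rewrite {1}IE.
  apply/seteqP; split=> f fD j; first by move=> _; apply: fD.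
  move=> _; have [-> | /fD//] := eqVneq j i.
  by apply: contrapT => NDif; apply: no_f; exists f.
have mD j : monomial_ideal (D j).
  by have [cj ->] := Dc j; apply: pure_power_ideal_monomial.
have [u fu NDiu] : exists2 u, u \in msupp f & ~ D i 'X_[u].
  apply: contrapT => no_u; apply: NDif; apply/(monomial_idealP _ (mD i)) => u fu.
  by apply: contrapT => NDiu; apply: no_u; exists u.
have le_uv : (u <= v)%MM.
  by apply: contrapT => Nle; apply: NDiu; rewrite DiE; apply/mem_corner_idealX.
rewrite IE => j _; have [-> | neq_ji] := eqVneq j i.
  rewrite DiE; apply/mem_corner_idealX => /mnm_lepP/(_ k).
  by rewrite mnmDE mnm1E eqxx addn1 ltnn.
have /(monomial_idealP _ (mD j))/(_ _ fu) Dju := fD j neq_ji.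
by apply: monomial_ideal_up (mD j) Dju (lepm_trans le_uv (lem_addr _ _)).
Qed.

End Decomposition.

(** A monomial [x^m] outside [I] is avoided by the irreducible ideal with
    exponents [m_i + 1] where [m_i < d] and no generator in the variables where
    [m_i >= d].  This ideal contains [I]: a monomial outside it becomes, once
    truncated at [d], a divisor of [x^m], and so is outside [I]. *)
Lemma exists_decomposition I : monomial_ideal I ->
  exists r (D : 'I_r -> set {mpoly K[n]}),
    irredundant_irreducible_decomposition I D.
Proof.
move=> mI.
have [d dP] : exists d, forall m, I 'X_[m] -> I 'X_[truncation d m].
  apply: (upset_truncation (M := [set m | I 'X_[m]])) => m m' Im lemm'.
  exact: monomial_ideal_up mI Im lemm'.
pose B := {ffun 'I_n -> 'I_d.+1}.
pose Q (c : B) := @pure_power_ideal K n [multinom (c i : nat) | i < n].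
pose C := [set c : B | `[< I `<=` Q c >]]%SET.
have IE : I = \bigcap_(c in [set c | c \in C]) Q c.
  apply/seteqP; split=> f.
    by move=> If c /=; rewrite finset.inE => /asboolP; apply.
  move=> Qf; apply/(monomial_idealP _ mI) => m fm.
  apply: contrapT => NIm.
  (* Exponent 0 means that the variable does not occur among the generators. *)
  pose c : B := [ffun i => if (m i < d)%N then inord (m i).+1 else ord0].
  have cE i : c i = (if (m i < d)%N then (m i).+1 else 0%N) :> nat.
    by rewrite ffunE; case: ifP => // ltmd; rewrite inordK // ltnS.
  have Cc : c \in C.
    rewrite finset.inE; apply/asboolP => g Ig.
    apply/mem_pure_power_ideal => u gu.
    have /(monomial_idealP _ mI)/(_ _ gu)/dP Iu := Ig.
    apply: contrapT => no_i; apply: NIm.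
    apply: monomial_ideal_up mI Iu _; apply/mnm_lepP => i; rewrite mnmE.
    have [ltmd | ] := ltnP (m i) d; last by move=> ledm; rewrite geq_min ledm orbT.
    rewrite geq_min leqNgt; apply/orP; left; apply/negP => ltmu; apply: no_i.
    by exists i; rewrite mnmE cE ltmd.
  have /mem_pure_power_ideal/(_ m fm)[i] := Qf c Cc.
  by rewrite mnmE cE; case: ifP => // _ _; rewrite ltnn.
pose cuts (A : {set B}) := `[< I = \bigcap_(c in [set c | c \in A]) Q c >].
have [A /minsetP[/asboolP IA minA] _] : {A | minset cuts A & A \subset C}.
  by apply: minset_exists; apply/asboolP.
exists #|A|, (fun i => Q (enum_val i)); split=> [i | | j Ij].
- by eexists.
- rewrite {1}IA; apply/seteqP; split=> f Qf.
    by move=> i _; apply: Qf; apply: enum_valP.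
  move=> c /= Ac; rewrite -(enum_rankK_in Ac Ac); exact: Qf.
(* If the component j could be omitted, A would not be minimal. *)
have: (A :\ enum_val j = A)%SET.
  apply: minA (subD1set _ _); apply/asboolP.
  rewrite {1}Ij; apply/seteqP; split=> f Qf.
    move=> c /=; rewrite in_setD1 => /andP[neqcj Ac].
    rewrite -(enum_rankK_in Ac Ac); apply: Qf => /=.
    by apply: contraNneq neqcj => <-; rewrite enum_rankK_in.
  move=> i /= neq_ij; apply: Qf => /=.
  by rewrite in_setD1 enum_valP (inj_eq enum_val_inj) neq_ij.
by move/setP/(_ (enum_val j)); rewrite in_setD1 eqxx enum_valP.
Qed.

Lemma maximal_irreducible_componentP I Q : monomial_ideal I ->
  (irreducible_component I Q /\ radical Q = maximal_homogeneous_ideal K n) <->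
  exists2 v, socle_monomial I v & Q = @pure_power_ideal K n (corner v).
Proof.
move=> mI; split=> [[[r [D [decI [i <-]]]] radQ] | [v soc_v ->]].
  exact: (maximal_component_socle decI radQ).
split; last by apply/radical_pure_power_idealP => i; rewrite mnmE.
have [r [D decI]] := exists_decomposition mI.
by exists r, D; split=> //; apply: (socle_monomial_component decI).
Qed.

End MonomialIdeals.

Theorem proposition6p2 (K : fieldType) (n : nat) (I P : set {mpoly K[n]})
    (hI : monomial_ideal I) (hP : P \in Ass I) :
  (exists! v : 'X_{1..n}, P = colon I 'X_[v]) <->
  (P = maximal_homogeneous_ideal K n /\
   exists! Q : set {mpoly K[n]}, irreducible_component I Q /\ radical Q = P).
Proof.
have pP : prime_ideal P by move: hP; rewrite inE => -[].
split=> [exv | [-> [Q [compQ Q_uniq]]]].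
  have PE := unique_colon_maximal hI pP exv; split=> //.
  move: exv => [v []]; rewrite PE => /(colon_maximalP _ hI) soc_v v_uniq.
  exists (@pure_power_ideal K n (corner v)); split=> [|Q].
    by apply/maximal_irreducible_componentP => //; exists v.
  case/(maximal_irreducible_componentP _ hI) => w soc_w ->.
  by rewrite (v_uniq w) //; apply/colon_maximalP.
have /(maximal_irreducible_componentP _ hI)[v soc_v QE] := compQ.
exists v; split=> [|w /(colon_maximalP _ hI) soc_w]; first exact/colon_maximalP.
apply: (@corner_ideal_inj K); rewrite -QE; apply: Q_uniq.
by apply/maximal_irreducible_componentP => //; exists w.
Qed.
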